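(* Let $T$ be a power bounded operator of class $C_{1\cdot}$ on a complex Hilbert space $\mathcal X$. If $T$ is weakly l-sequentially supercyclic, then $$\sigma_P(T)=\sigma_P(T^* )=\varnothing .$$
   Context: An operator on a Hilbert space $\mathcal X$ is a bounded linear transformation of $\mathcal X$ into itself; $T^*$ is the Hilbert-space adjoint and $\sigma_P(\cdot)$ denotes the point spectrum (set of eigenvalues). An operator $T$ on $\mathcal X$ is power bounded if $\sup_n\|T^n\|<\infty$; it is of class $C_{1\cdot}$ if for every nonzero $x\in\mathcal X$ the sequence $\{T^nx\}$ does not converge to $0$ in norm. A nonzero vector $y\in\mathcal X$ is weakly l-sequentially supercyclic for $T$ if for every $x\in\mathcal X$ there is a sequence of nonzero complex numbers $\{\alpha_i\}_{i\ge0}$ and a subsequence $\{T^{n_i}\}_{i\ge0}$ of $\{T^n\}_{n\ge0}$ such that $\alpha_iT^{n_i}y$ converges weakly to $x$. The operator $T$ is weakly l-sequentially supercyclic if it has a weakly l-sequentially supercyclic vector.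
   Formalization: The Hilbert space is assumed not to be one-dimensional; in dimension one the claim is false (the identity on the complex numbers satisfies every hypothesis but has eigenvalue 1). *)

(* Defs.v *)
From HB Require Import structures.
From mathcomp Require Import all_boot all_order all_algebra sesquilinear.
From mathcomp Require Import complex.
From mathcomp Require Import all_classical all_reals all_analysis.

Set Implicit Arguments.
Unset Strict Implicit.
Unset Printing Implicit Defensive.

Import Order.TTheory GRing.Theory Num.Theory.
Import numFieldNormedType.Exports.

Local Open Scope classical_set_scope.
Local Open Scope ring_scope.

(* A complex Hilbert space is a complete normed space [X] over [R[i]] together
   with an inner product [dot : {dot X for Num.conj}] (linear in its first
   argument, conjugate-linear in its second) that induces the norm of [X]. *)
Definition induces_norm (R : realType) (X : completeNormedModType R[i])
    (dot : {dot X for Num.conj}) : Prop :=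
  forall x : X, `|x| ^+ 2 = dot x x.

Definition one_dimensional (R : realType) (X : completeNormedModType R[i]) : Prop :=
  exists2 e : X, e != 0 & forall x : X, exists a : R[i], x = a *: e.

(* Norms of a space over [R[i]] are nonnegative elements of [R[i]]; [Re] only
   moves them to [R], where suprema are available. *)
Definition opnorm (R : realType) (X : completeNormedModType R[i])
    (f : X -> X) : \bar R :=
  ereal_sup [set (complex.Re `|f x|)%:E | x in [set x : X | `|x| <= 1]].

Definition bounded_operator (R : realType) (X : completeNormedModType R[i])
    (T : X -> X) : Prop :=
  (opnorm T < +oo)%E.

Definition power_bounded (R : realType) (X : completeNormedModType R[i])
    (T : X -> X) : Prop :=
  (ereal_sup (range (fun n : nat => opnorm (iter n T))) < +oo)%E.

Definition class_C1 (R : realType) (X : completeNormedModType R[i])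
    (T : X -> X) : Prop :=
  forall x : X, x != 0 -> ~ (iter n T x @[n --> \oo] --> (0 : X)).

Definition weakly_converges (R : realType) (X : completeNormedModType R[i])
    (dot : {dot X for Num.conj}) (u : nat -> X) (x : X) : Prop :=
  forall z : X, dot (u i) z @[i --> \oo] --> dot x z.

Definition weakly_l_seq_supercyclic_vector (R : realType)
    (X : completeNormedModType R[i]) (dot : {dot X for Num.conj})
    (T : X -> X) (y : X) : Prop :=
  y != 0 /\
  forall x : X, exists (alpha : nat -> R[i]) (n : nat -> nat),
    [/\ forall i, alpha i != 0,
        {homo n : i j / (i < j)%N}
      & weakly_converges dot (fun i => alpha i *: iter (n i) T y) x].

Definition weakly_l_seq_supercyclic (R : realType)
    (X : completeNormedModType R[i]) (dot : {dot X for Num.conj})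
    (T : X -> X) : Prop :=
  exists y : X, weakly_l_seq_supercyclic_vector dot T y.

(* For a bounded [T] on a Hilbert space, the vector selected at [y] exists by
   the Riesz representation theorem, and is unique. *)
Definition adjoint (R : realType) (X : completeNormedModType R[i])
    (dot : {dot X for Num.conj}) (T : X -> X) : X -> X :=
  fun y => get [set z : X | forall x : X, dot (T x) y = dot x z].

Definition point_spectrum (R : realType) (X : completeNormedModType R[i])
    (T : X -> X) : set R[i] :=
  [set l | exists2 x : X, x != 0 & T x = l *: x].

(* Main.v *)
Require Import Defs.
From HB Require Import structures.
From mathcomp Require Import all_boot all_order all_algebra sesquilinear.
From mathcomp Require Import complex ring.
From mathcomp Require Import all_classical all_reals all_analysis.

Import Order.TTheory GRing.Theory Num.Theory.
Import numFieldNormedType.Exports.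

Local Open Scope classical_set_scope.
Local Open Scope ring_scope.

(** Call a nonzero z a left eigenvector of T for c when
    <T x, z> = c <x, z> for all x; this is an eigenvector of the adjoint for the
    conjugate of c, once Riesz representation shows that the adjoint is really
    there.  Everything comes down to two facts.

    A power bounded, weakly supercyclic T of class C1 has no left eigenvector
    in dimension at least 2 ([no_left_eigenvector]).  Let y be supercyclic and
    a_i T^(n_i) y converge weakly to x.  Pairing with z gives
    a_i c^(n_i) <y, z> -> <x, z>.  If |c| >= 1, choose x nonzero and orthogonal
    to z: then a_i -> 0, as <y, z> is nonzero by the case x = z, and since the
    orbit of y is bounded, a_i T^(n_i) y tends to 0 in norm, so x = 0.  If
    |c| < 1, choose x = z: weakly convergent sequences are norm bounded
    ([uniform_boundedness]), and class C1 together with power boundedness keeps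
    the orbit of y away from 0
    ([orbit_bounded_below]), so the a_i are bounded and a_i c^(n_i) -> 0, which
    forces <z, z> = 0.

    An eigenvector T e = l e gives a left eigenvector for the same l.  Class C1
    excludes |l| < 1.  Otherwise S = T / l is power bounded and fixes e, and the
    mean ergodic argument ([eigenvector_far_from_range]) shows that e is not in
    the closure of the range of 1 - S: Cesaro means fix e, are uniformly
    bounded, and tend to 0 on that range.  The component z of e orthogonal to
    the range is then nonzero, and <x - S x, z> = 0 says exactly that z is a
    left eigenvector. *)

(** * Complex scalars *)

Lemma complex_archimedean (R : realType) (x : R[i]) :
  0 <= x -> exists n : nat, x < n%:R.
Proof.
move=> x0; exists (Num.trunc (complex.Re x)).+1.
rewrite -(RRe_real (ger0_real x0)) -(rmorph_nat (@real_complex R)) ltcR.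
by rewrite truncnS_gt.
Qed.

Lemma complex_expr_lt (R : realType) (q e : R[i]) :
  `|q| < 1 -> 0 < e -> exists N, forall n, (N <= n)%N -> `|q| ^+ n < e.
Proof.
move=> q1 e0; set r := complex.Re `|q|.
have rE : `|q| = r%:C%C by rewrite RRe_real.
have r0 : 0 <= r by rewrite -lecR -rE; exact: normr_ge0.
have r1 : `|r| < 1 by rewrite ger0_norm// -ltcR -rE.
have eE : e = (complex.Re e)%:C%C by rewrite RRe_real// gtr0_real.
have /cvgr0_norm_lt/(_ (complex.Re e)) := cvg_expr r1.
rewrite -ltcR -eE => /(_ e0)[N _ NP]; exists N => n /NP /=.
by rewrite normrX (ger0_norm r0) -ltcR -eE rmorphXn/= -rE.
Qed.

Lemma norm_cvg_le (R : realType)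
    (V : pseudoMetricNormedZmodType R[i]) (u : nat -> V) (l v : V) (b : R[i]) :
  u n @[n --> \oo] --> l -> (\forall n \near \oo, `|u n - v| <= b) ->
  `|l - v| <= b.
Proof.
move=> /cvgrPdist_lt ul [N _ Nb].
have b0 : b \is Num.real.
  by rewrite ger0_real//; apply: le_trans (Nb N (leqnn N)).
rewrite real_leNgt ?normr_real//; apply/negP => blt.
have /ul[K _ /(_ (maxn N K) (leq_maxr _ _))/= uK] : 0 < `|l - v| - b.
  by rewrite subr_gt0.
have := le_lt_trans (ler_distD (u (maxn N K)) l v)
  (ltr_leD uK (Nb (maxn N K) (leq_maxl _ _))).
by rewrite subrK ltxx.
Qed.

(** * Geometry of a complex Hilbert space *)

Section HilbertSpace.
Set Implicit Arguments.
Unset Strict Implicit.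
Context (R : realType) (X : completeNormedModType R[i]).
Context (dot : {dot X for Num.conj}) (hdot : induces_norm dot).

Lemma dotC (x y : X) : dot x y = (dot y x)^*.
Proof. by rewrite hermC expr0 mul1r. Qed.

Lemma dotZr (a : R[i]) (x y : X) : dot x (a *: y) = a^* * dot x y.
Proof. by rewrite linearZr_LR. Qed.

Lemma sqr_norm_sub (a : R[i]) (x y : X) :
  `|x - a *: y| ^+ 2 =
  `|x| ^+ 2 - a^* * dot x y - a * (dot x y)^* + `|a| ^+ 2 * `|y| ^+ 2.
Proof.
rewrite !hdot linearBl/= !linearBr/= !dotZr !linearZl_LR/= -(dotC y x) normCK.
by ring.
Qed.

(** Minimising over a gives the value |x|^2 - |<x, m>|^2 / |m|^2.  The slack s
    serves two extremes: s = |x|^2 yields Cauchy-Schwarz, and small s says that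
    a nearly shortest representative of x modulo a subspace is nearly orthogonal
    to it. *)
Lemma almost_minimal_almost_orthogonal (s : R[i]) (x m : X) :
  (forall a, `|x| ^+ 2 - s <= `|x - a *: m| ^+ 2) ->
  `|dot x m| ^+ 2 <= s * `|m| ^+ 2.
Proof.
have [->|m0] := eqVneq m 0.
  by rewrite linear0r !normr0 expr0n/= => _; rewrite mulr0.
(* the minimising coefficient *)
move=> /(_ (dot x m / `|m| ^+ 2)); rewrite sqr_norm_sub.
have n0 : `|m| ^+ 2 != 0 by rewrite expf_neq0// normr_eq0.
have nc : (`|m| ^+ 2)^* = `|m| ^+ 2 by rewrite geC0_conj ?exprn_ge0.
rewrite rmorphM/= fmorphV/= nc normrM normfV normrX normr_id.
have -> : `|x| ^+ 2 - (dot x m)^* / `|m| ^+ 2 * dot x m -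
   dot x m / `|m| ^+ 2 * (dot x m)^* +
   (`|dot x m| / `|m| ^+ 2) ^+ 2 * `|m| ^+ 2 =
   `|x| ^+ 2 - `|dot x m| ^+ 2 / `|m| ^+ 2.
  rewrite exprMn !normCK; field.
  by rewrite normr_eq0.
by rewrite lerD2l lerN2 ler_pdivrMr// exprn_gt0// normr_gt0.
Qed.

Lemma cauchy_schwarz (x y : X) : `|dot x y| <= `|x| * `|y|.
Proof.
rewrite -(@ler_pXn2r _ 2)// ?nnegrE ?mulr_ge0// exprMn.
apply: almost_minimal_almost_orthogonal => a.
by rewrite subrr exprn_ge0.
Qed.

Lemma norm_dot_cvg (u : nat -> X) (x y : X) :
  u n @[n --> \oo] --> x -> dot (u n) y @[n --> \oo] --> dot x y.
Proof.
move=> ux; apply/cvgrPdist_lt => e e0.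
have y0 : 0 < `|y| + 1 by rewrite ltr_wpDl.
have /cvgrPdist_lt/(_ (e / (`|y| + 1))) := ux.
rewrite divr_gt0// => /(_ isT); apply: filterS => n; rewrite ltr_pdivlMr// => h.
rewrite -linearBl/=; apply: le_lt_trans (cauchy_schwarz _ _) (le_lt_trans _ h).
by rewrite ler_wpM2l// lerDl.
Qed.

Lemma cauchy_sequence_cvg (u : nat -> X) (eps : nat -> R[i]) :
  (forall e, 0 < e -> exists n, eps n < e) ->
  (forall m n, (m <= n)%N -> `|u m - u n| <= eps m) ->
  exists l : X, u n @[n --> \oo] --> l.
Proof.
move=> eps0 ule; apply/cvg_ex; apply: cauchy_cvg; apply: cauchy_exP => e e0.
have [N epsN] := eps0 e e0.
exists (u N); exists N => // n /= Nn.
by rewrite /ball_ /= -ball_normE/=; apply: le_lt_trans (ule _ _ Nn) _.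
Qed.

(** The projection of e on the closure of M exists by completeness: if u k comes
    within 1/(k+1)^2 of the infimum of |e - m|^2, then e - u k is orthogonal to M
    up to 1/(k+1), which makes u a Cauchy sequence and its limit's residue z
    exactly orthogonal to M.  The closure is expressed by the sequence u. *)
Lemma orthogonal_decomposition (M : set X) (e : X) :
  M 0 -> (forall a u v, M u -> M v -> M (a *: u + v)) ->
  exists (z : X) (u : nat -> X),
    [/\ forall m, M m -> dot z m = 0, forall k, M (u k)
      & u k @[k --> \oo] --> e - z].
Proof.
move=> M0 MD.
pose D : set R := [set complex.Re (`|e - m| ^+ 2) | m in M].
have sqC m : (complex.Re (`|e - m| ^+ 2))%:C%C = `|e - m| ^+ 2.
  by rewrite RRe_real// ger0_real ?exprn_ge0.
have Dinf : has_inf D.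
  split; first by exists (complex.Re (`|e - 0| ^+ 2)); exists 0.
  exists 0 => _ [m _ <-]; rewrite -lecR sqC; exact: exprn_ge0.
have minD m : M m -> (inf D)%:C%C <= `|e - m| ^+ 2.
  move=> Mm; rewrite -sqC lecR; apply: ge_inf; first exact: Dinf.2.
  by exists m.
have ex k : exists m, M m /\ `|e - m| ^+ 2 < (inf D)%:C%C + k.+1%:R^-1 ^+ 2.
  have k0 : 0 < (k.+1%:R^-1 : R) ^+ 2 by rewrite exprn_gt0.
  have [_ [m Mm <-] mlt] := inf_adherent k0 Dinf.
  exists m; split=> //; rewrite -sqC.
  move: mlt; rewrite -ltcR rmorphD/= rmorphXn/= fmorphV/=.
  by rewrite -(rmorph_nat (@real_complex R)).
have {ex} [u uP] := choice ex.
have almost k m : M m -> `|dot (e - u k) m| <= k.+1%:R^-1 * `|m|.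
  move=> Mm; rewrite -(@ler_pXn2r _ 2)// ?nnegrE ?mulr_ge0// exprMn.
  apply: almost_minimal_almost_orthogonal => a.
  rewrite -addrA -opprD lerBlDr; apply: le_trans (ltW (uP k).2) _.
  by rewrite lerD2r (addrC (u k)) minD//; apply: MD => //; exact: (uP k).1.
have udist m n : (m <= n)%N -> `|u m - u n| <= m.+1%:R^-1 *+ 2.
  move=> mn; have [->|n0] := eqVneq (u m) (u n).
    by rewrite subrr normr0 mulrn_wge0.
  have Md : M (u m - u n).
    by rewrite addrC -scaleN1r; apply: MD; [exact: (uP n).1|exact: (uP m).1].
  have p : 0 < `|u m - u n| by rewrite normr_gt0 subr_eq0.
  rewrite -(ler_pM2r p) -expr2 hdot.
  (* |u m - u n|^2 pairs an element of M with two almost orthogonal residues *)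
  have dE : dot (u m - u n) (u m - u n) =
      dot (e - u n) (u m - u n) - dot (e - u m) (u m - u n).
    rewrite -linearBl/=; congr (dot _ _).
    by rewrite [RHS]addrC opprB addrA subrK.
  rewrite -[leLHS]ger0_norm -?hdot ?exprn_ge0// hdot dE.
  rewrite mulr2n mulrDl; apply: le_trans (ler_normB _ _) _.
  apply: lerD; last exact: almost.
  apply: le_trans (almost _ _ Md) _; rewrite ler_wpM2r// lef_pV2 ?posrE//.
  by rewrite ler_nat ltnS.
have [] := cauchy_sequence_cvg _ udist.
  move=> eps eps0.
  have [|n nP] := @complex_archimedean R (2 / eps).
    by rewrite divr_ge0// ltW.
  exists n; rewrite -[_ *+ 2]mulr_natl ltr_pdivrMr// mulrC -ltr_pdivrMr//.
  by apply: lt_trans nP _; rewrite ltr_nat.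
move=> l ul; exists (e - l), u; split.
- move=> m Mm.
  have ucvg : (e - u k) @[k --> \oo] --> e - l.
    by apply: cvgB => //; exact: cvg_cst.
  apply/eqP; rewrite -normr_eq0 eq_le normr_ge0 andbT.
  rewrite real_leNgt ?normr_real ?real0//; apply/negP => d0.
  have [|n nP] := @complex_archimedean R (`|m| / `|dot (e - l) m|).
    by rewrite divr_ge0.
  have n0 : 0 < n%:R :> R[i].
    by apply: le_lt_trans nP; rewrite divr_ge0.
  have : `|dot (e - l) m - 0| <= n%:R^-1 * `|m|.
    apply: norm_cvg_le (norm_dot_cvg ucvg) _.
    exists n => // k /= nk; rewrite subr0; apply: le_trans (almost k m Mm) _.
    by rewrite ler_wpM2r// lef_pV2 ?posrE// ler_nat (leq_trans nk).
  rewrite subr0 ler_pdivlMl// => h.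
  by move: nP; rewrite ltr_pdivrMr// => /(le_lt_trans h); rewrite ltxx.
- by move=> k; exact: (uP k).1.
- by rewrite opprB addrC subrK.
Qed.

(** The component z of some e with f e <> 0 orthogonal to ker f satisfies
    f z = f e <> 0, since f is continuous; and x - (f x / f z) z lies in ker f. *)
Lemma riesz_representation (f : {linear X -> R[i] | *%R}) (C : R[i]) :
  (forall x, `|f x| <= C * `|x|) -> exists z, forall x, f x = dot x z.
Proof.
move=> fC; have [[e fe]|f0] := pselect (exists e, f e != 0); last first.
  exists 0 => x; rewrite linear0r; apply/eqP; apply: contra_notT f0 => fx.
  by exists x.
have [||z [u [zM uM ue]]] := @orthogonal_decomposition [set x | f x = 0] e.
- by rewrite /= linear0.
- by move=> a x y /= fx fy; rewrite linearP fx fy mulr0 addr0.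
have fze : f z = f e.
  apply/eqP; rewrite eq_sym -subr_eq0 -linearB -normr_eq0.
  rewrite eq_le normr_ge0 andbT.
  rewrite real_leNgt ?normr_real ?real0//; apply/negP => d0.
  have C0 : 0 < C + 1.
    rewrite ltr_wpDl//; have := le_trans (normr_ge0 _) (fC e).
    rewrite pmulr_lge0// normr_gt0; apply: contraNneq fe => ->.
    by rewrite linear0.
  have /cvgrPdist_lt/(_ (`|f (e - z)| / (C + 1))) := ue.
  rewrite divr_gt0// => /(_ isT)[N _ /(_ N (leqnn _))/=].
  rewrite ltr_pdivlMr// => h; have := fC (e - z - u N).
  rewrite linearB (uM N) subr0 => /(lt_le_trans h).
  by rewrite mulrDr mulrC mulr1 gtrDl normr_lt0.
have z0 : dot z z != 0.
  rewrite -hdot expf_neq0// normr_eq0; apply: contraNneq fe => z0.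
  by rewrite -fze z0 linear0.
have fz0 : f z != 0 by rewrite fze.
exists ((f z / dot z z)^* *: z) => x; rewrite dotZr conjCK.
have : f (x - (f x / f z) *: z) = 0.
  by rewrite linearB linearZ/= divfK ?subrr.
move/zM/(congr1 Num.conj); rewrite -dotC rmorph0 linearBl/= linearZl_LR/=.
move/eqP; rewrite subr_eq0 => /eqP ->.
by field; rewrite z0 andbT; exact: fz0.
Qed.

(** A gliding hump replaces the Baire category theorem.  If the u i are unbounded,
    pick v k among them with |v k| > k 3^k, and build x_ k by steps of length at
    most 3^-k such that |<v k, x_ k.+1>| >= 3^-k |v k|.  All later steps move the
    point by at most 3^-k / 2 in total, so the limit x keeps
    |<v k, x>| >= 3^-k |v k| / 2 > k / 2. *)
Lemma uniform_boundedness (u : nat -> X) :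
  (forall z, exists B, forall i, `|dot (u i) z| <= B) ->
  exists B, forall i, `|u i| <= B.
Proof.
move=> ptb; apply: contrapT => unb.
pose p k : R[i] := 3^-1 ^+ k.
have p0 k : 0 < p k by rewrite exprn_gt0.
have pS k : p k.+1 = p k / 3 by rewrite /p exprSr.
have big k : exists i, k%:R / p k < `|u i|.
  apply: contrapT => nk; apply: unb; exists (k%:R / p k) => i.
  rewrite real_leNgt ?normr_real//; last by rewrite ger0_real// divr_ge0// ltW.
  by apply/negP => ki; apply: nk; exists i.
have {big unb} [i iP] := choice big.
pose v k := u (i k).
have v0 k : 0 < `|v k| by apply: le_lt_trans (iP k); rewrite divr_ge0// ltW.
(* one of x + w and x - w works: their pairings with v k differ by
   2 p k |v k| *)
have step (k : nat) (x : X) : exists x', `|x - x'| <= p k /\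
    p k * `|v k| <= `|dot (v k) x'|.
  pose w := (p k / `|v k|) *: v k.
  have nw : `|w| = p k.
    by rewrite normrZ normrM normfV normr_id (gtr0_norm (p0 k)) divfK// gt_eqF.
  have dw : dot (v k) w = p k * `|v k|.
    rewrite dotZr -hdot geC0_conj; last by rewrite divr_ge0// ltW.
    by rewrite expr2 mulrA divfK// gt_eqF.
  have [h|h] := real_leP (ger0_real (mulr_ge0 (ltW (p0 k)) (ltW (v0 k))))
    (normr_real (dot (v k) (x + w))).
    by exists (x + w); rewrite opprD addNKr normrN nw.
  exists (x - w); rewrite opprB addrC subrK nw; split=> //.
  rewrite real_leNgt ?normr_real//; last by rewrite ger0_real// mulr_ge0// ltW.
  apply/negP => h'; have := le_lt_trans (ler_normB _ _) (ltrD h h').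
  have -> : dot (v k) (x + w) - dot (v k) (x - w) = (p k * `|v k|) *+ 2.
    by rewrite linearDr linearBr/= dw; ring.
  by rewrite mulr2n ger0_norm ?ltxx// addr_ge0// mulr_ge0// ltW.
have {step} [g gP] := choice (fun kx : nat * X => step kx.1 kx.2).
pose fix x_ k := if k is k'.+1 then g (k', x_ k') else 0.
have x_S k : x_ k.+1 = g (k, x_ k) by [].
have x_d m n : (m <= n)%N -> `|x_ m - x_ n| <= 3 / 2 * (p m - p n).
  move=> /subnKC<-; elim: (n - m)%N => [|d IH].
    by rewrite addn0 !subrr normr0 mulr0.
  rewrite addnS.
  apply: le_trans (ler_distD (x_ (m + d)%N) _ _) _.
  have h := (gP ((m + d)%N, x_ (m + d)%N)).1.
  apply: le_trans (lerD IH h) _ => /=.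
  by rewrite pS le_eqVlt; apply/orP; left; apply/eqP; field.
have x_p m n : (m <= n)%N -> `|x_ m - x_ n| <= 3 / 2 * p m.
  move=> /x_d h; apply: le_trans h _; rewrite ler_wpM2l ?divr_ge0//.
  by rewrite gerBl ltW.
have [|x xP] := cauchy_sequence_cvg _ x_p.
  move=> e e0; have [||n h] := @complex_expr_lt R 3^-1 (2 / 3 * e).
  - by rewrite normfV normr_nat invf_lt1// ltr1n.
  - by rewrite mulr_gt0// divr_gt0.
  exists n; have := h n (leqnn n); rewrite normfV normr_nat -/(p n).
  by rewrite -ltr_pdivlMl ?divr_gt0// invf_div.
have xk k : `|x - x_ k.+1| <= p k / 2.
  apply: norm_cvg_le xP _; exists k.+1 => // n /= kn; rewrite distrC.
  apply: le_trans (x_p _ _ kn) _; rewrite pS.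
  by rewrite le_eqVlt; apply/orP; left; apply/eqP; field.
have [B BP] := ptb x.
have B0 : 0 <= B := le_trans (normr_ge0 _) (BP 0%N).
have [|n nP] := @complex_archimedean R (2 * B); first by rewrite mulr_ge0.
have le1 : p n * `|v n| <= B + `|v n| * (p n / 2).
  apply: le_trans (gP (n, x_ n)).2 _ => /=; rewrite -x_S.
  rewrite -[x_ n.+1](subKr x) linearBr/=.
  apply: le_trans (ler_normB _ _) (lerD (BP (i n)) _).
  apply: le_trans (cauchy_schwarz _ _) _.
  by rewrite ler_wpM2l// xk.
have le2 : p n * `|v n| <= 2 * B.
  rewrite -subr_ge0.
  have -> : 2 * B - p n * `|v n| = 2 * (B + `|v n| * (p n / 2) - p n * `|v n|).
    by field.
  by rewrite mulr_ge0// subr_ge0.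
have := iP n; rewrite ltr_pdivrMr// mulrC.
by move=> /lt_le_trans/(_ le2)/lt_trans/(_ nP); rewrite ltxx.
Qed.

End HilbertSpace.

(** * Power bounded operators *)

Section PowerBoundedOperator.
Set Implicit Arguments.
Unset Strict Implicit.
Context (R : realType) (X : completeNormedModType R[i]).
Context (dot : {dot X for Num.conj}) (hdot : induces_norm dot).
Context (T : {linear X -> X}).

Lemma iter_linearZ n (a : R[i]) (x : X) : iter n T (a *: x) = a *: iter n T x.
Proof. by elim: n => //= n ->; rewrite linearZ. Qed.

Lemma iter_eigenvector (l : R[i]) (e : X) n :
  T e = l *: e -> iter n T e = l ^+ n *: e.
Proof.
move=> Te; elim: n => [|n IH]; first by rewrite expr0 scale1r.
by rewrite /= IH linearZ/= Te scalerA exprSr.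
Qed.

Lemma power_bounded_norm :
  power_bounded T ->
  exists2 M : R[i], 0 < M & forall n x, `|iter n T x| <= M * `|x|.
Proof.
move=> pb.
have [r rP] : exists r : R,
    (ereal_sup (range (fun n : nat => opnorm (iter n T))) <= r%:E)%E.
  move: pb; rewrite /power_bounded; case: (ereal_sup _) => [r _| |_] //.
  - by exists r.
  - by exists 0; rewrite leNye.
pose M : R := `|r| + 1.
have M0 : 0 < M by rewrite ltr_wpDl.
exists M%:C%C => [|n x]; first by rewrite ltcR.
have [->|x0] := eqVneq x 0.
  by rewrite -(scale0r 0) iter_linearZ !scale0r normr0 mulr0.
have nx : 0 < `|x| by rewrite normr_gt0.
have nrm1 : `| (`|x|^-1 *: x) | <= 1.
  by rewrite normrZ normfV normr_id mulVf// normr_eq0.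
rewrite mulrC -ler_pdivrMl//.
have -> : `|x|^-1 * `|iter n T x| = `|iter n T (`|x|^-1 *: x)|.
  by rewrite iter_linearZ normrZ normfV normr_id.
rewrite -[leLHS]RRe_real ?normr_real// lecR.
apply: (@le_trans _ _ r); last by rewrite /M (le_trans (ler_norm r))// lerDl.
rewrite -lee_fin; apply: le_trans rP.
apply: (@le_trans _ _ (opnorm (iter n T))).
  by apply: ereal_sup_ubound; exists (`|x|^-1 *: x).
by apply: ereal_sup_ubound; exists n.
Qed.

Context (M : R[i]) (M0 : 0 < M) (TM : forall n x, `|iter n T x| <= M * `|x|).

Lemma dot_adjoint (x y : X) : dot (T x) y = dot x (adjoint dot T y).
Proof.
pose f x := dot (T x) y.
have fl : linear_for *%R f by move=> a u v; rewrite /f linearP linearPl.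
pose F : {linear X -> R[i] | *%R} := HB.pack f (GRing.isLinear.Build _ _ _ _ f fl).
have [u|z zP] := @riesz_representation _ _ _ hdot F (M * `|y|).
  apply: le_trans (cauchy_schwarz hdot _ _) _.
  by rewrite mulrAC ler_wpM2r// (TM 1%N).
have := @getPex _ [set z | forall x, dot (T x) y = dot x z].
by apply; exists z => u; apply: zP.
Qed.

(** If the orbit came arbitrarily close to 0, power boundedness would keep it
    there from that time on, and it would converge to 0. *)
Lemma orbit_bounded_below (y : X) :
  class_C1 T -> y != 0 ->
  exists2 d : R[i], 0 < d & forall n, d <= `|iter n T y|.
Proof.
move=> C1 y0; apply: contrapT => nd; apply: (C1 y y0).
apply/cvgr0Pnorm_lt => e e0.
have [n nP] : exists n, `|iter n T y| < e / M.
  apply: contrapT => nn; apply: nd; exists (e / M); first exact: divr_gt0.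
  move=> n; rewrite real_leNgt ?normr_real//; last by rewrite gtr0_real ?divr_gt0.
  by apply/negP => h; apply: nn; exists n.
exists n => // m /= /subnK <-; rewrite iterD.
by apply: le_lt_trans (TM _ _) _; rewrite mulrC -ltr_pdivlMr.
Qed.

(** Put S = T / l, so that |S^n| <= M, S e = e, and let w = e - (x - S x).  The
    sum of S^k w over k < n telescopes to n e - x + S^n x, so n |e| is at most
    n M |w| + (1 + M) |x|; dividing by n and letting n grow gives the bound. *)
Lemma eigenvector_far_from_range (l : R[i]) (e : X) :
  1 <= `|l| -> T e = l *: e ->
  forall x, `|e| <= M * `|e - (x - l^-1 *: T x)|.
Proof.
move=> l1 Te x; set w := e - (x - l^-1 *: T x).
have l0 : l != 0 by rewrite -normr_gt0 (lt_le_trans _ l1).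
pose S n v := l ^- n *: iter n T v.
have SM n v : `|S n v| <= M * `|v|.
  rewrite normrZ; apply: le_trans (TM n v); rewrite ler_piMl//.
  by rewrite normfV normrX invf_le1 ?exprn_gt0 ?exprn_ege1// (lt_le_trans _ l1).
have SB n u v : S n (u - v) = S n u - S n v.
  rewrite /S; have -> : iter n T (u - v) = iter n T u - iter n T v.
    by elim: n => //= n ->; rewrite linearB.
  by rewrite scalerBr.
have Se n : S n e = e.
  by rewrite /S (iter_eigenvector _ Te) scalerA mulVf ?scale1r// expf_neq0.
have SS n v : S n (l^-1 *: T v) = S n.+1 v.
  by rewrite /S iter_linearZ -iterSr scalerA exprS invfM mulrC.
have tel n : `|e *+ n - x + S n x| <= n%:R * (M * `|w|).
  elim: n => [|n IH].
    by rewrite /S mulr0n sub0r expr0 invr1 scale1r addNr normr0 mul0r.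
  have -> : e *+ n.+1 - x + S n.+1 x = (e *+ n - x + S n x) + S n w.
    rewrite /w !SB Se SS opprB [S n.+1 x - _]addrC [e + _]addrCA.
    by rewrite [RHS]addrA addrK mulrSr [e *+ n + e - x]addrAC [RHS]addrA.
  rewrite -natr1 mulrDl mul1r.
  exact: le_trans (ler_normD _ _) (lerD IH (SM _ _)).
have bnd n : n%:R * (`|e| - M * `|w|) <= (1 + M) * `|x|.
  rewrite mulrBr lerBlDl mulr_natl -normrMn.
  have -> : e *+ n = (e *+ n - x + S n x) + (x - S n x).
    by rewrite [RHS]addrA [RHS]addrAC addrK subrK.
  apply: le_trans (ler_normD _ _) (lerD (tel n) _).
  apply: le_trans (ler_normB _ _) _.
  by rewrite mulrDl mul1r lerD2l.
rewrite real_leNgt ?normr_real//; last by rewrite ger0_real// mulr_ge0// ltW.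
apply/negP; rewrite -subr_gt0 => d0.
have [|n nP] := @complex_archimedean R ((1 + M) * `|x| / (`|e| - M * `|w|)).
  by rewrite divr_ge0 ?(ltW d0)// mulr_ge0// addr_ge0// ltW.
by move: nP; rewrite ltr_pdivrMr// => /lt_le_trans/(_ (bnd n)); rewrite ltxx.
Qed.

(** By the previous bound e is not a limit of vectors x - T x / l, so its component
    orthogonal to their span is nonzero. *)
Lemma eigenvector_gives_left_eigenvector (l : R[i]) (e : X) :
  1 <= `|l| -> e != 0 -> T e = l *: e ->
  exists2 z, z != 0 & forall x, dot (T x) z = l * dot x z.
Proof.
move=> l1 e0 Te.
have l0 : l != 0 by rewrite -normr_gt0 (lt_le_trans _ l1).
have [||z [u [zM uM ue]]] := @orthogonal_decomposition _ _ _ hdot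
    [set x - l^-1 *: T x | x in setT] e.
- by exists 0 => //; rewrite linear0 scaler0 subr0.
- move=> a _ _ [x _ <-] [y _ <-]; exists (a *: x + y) => //.
  by rewrite linearP scalerDr scalerBr !scalerA mulrC opprD addrACA.
exists z.
  apply: contra_neq e0 => z0; apply/eqP; rewrite -normr_eq0 eq_le normr_ge0 andbT.
  rewrite z0 subr0 in ue.
  rewrite real_leNgt ?normr_real ?real0//; apply/negP => p.
  have /cvgrPdist_lt/(_ (`|e| / M)) := ue.
  rewrite divr_gt0// => /(_ isT)[N _ /(_ N (leqnn _))/=].
  have [x _ <-] := uM N; rewrite ltr_pdivlMr// mulrC.
  move=> /(le_lt_trans (eigenvector_far_from_range l1 Te x)).
  by rewrite ltxx.
move=> x.
have /zM : [set x - l^-1 *: T x | x in setT] (x - l^-1 *: T x) by exists x.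
rewrite dotC => /eqP; rewrite conjC_eq0 linearBl/= linearZl_LR/= subr_eq0.
move=> /eqP ->; by rewrite mulrA mulfV// mul1r.
Qed.

(** The weak limit constrains the coefficients alpha i only through their pairing
    with z, so the target x is chosen according to the size of c: orthogonal to z
    when the powers of c do not decay, and z itself when they do. *)
Lemma no_left_eigenvector (c : R[i]) (z : X) :
  ~ one_dimensional X -> class_C1 T -> weakly_l_seq_supercyclic dot T ->
  z != 0 -> ~ (forall x, dot (T x) z = c * dot x z).
Proof.
move=> dim1 C1 [y [y0 ysc]] z0 Tz.
have Tnz n x : dot (iter n T x) z = c ^+ n * dot x z.
  by elim: n => [|n IH]; rewrite ?expr0 ?mul1r//= Tz IH exprS mulrA.
have zz0 : dot z z != 0 by rewrite -hdot expf_neq0// normr_eq0.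
have [c1|c1] := real_leP (@real1 R[i]) (normr_real c).
- have [x x0 xz] : exists2 x, x != 0 & dot x z = 0.
    have [x nx] : exists x, forall a, x != a *: z.
      apply: contrapT => nx; apply: dim1; exists z => // x.
      apply: contrapT => na; apply: nx; exists x => a; apply/eqP => xa.
      by apply: na; exists a.
    exists (x - (dot x z / dot z z) *: z); first by rewrite subr_eq0.
    by rewrite linearBl/= linearZl_LR/= divfK// subrr.
  have yz : dot y z != 0.
    apply: contra_neq zz0 => yz; have [alpha [n [_ _ /(_ z) wcv]]] := ysc z.
    apply: (norm_cvg_unique wcv); apply/cvgr0Pnorm_le => e e0.
    apply: nearW => i; rewrite linearZl_LR/= Tnz yz !mulr0 normr0; exact: ltW.
  (* alpha i tends to 0 because alpha i * c ^+ n i does *)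
  have [alpha [n [_ _ wcv]]] := ysc x.
  have : dot x x = 0.
    apply: (norm_cvg_unique (wcv x)); apply/cvgr0Pnorm_le => e e0.
    have := wcv z; rewrite xz => /cvgr0_norm_lt.
    pose b := M * `|y| * `|x| + 1.
    have b0 : 0 < b by rewrite ltr_wpDl// !mulr_ge0// ltW.
    move=> /(_ (e / b * `|dot y z|)).
    rewrite mulr_gt0 ?normr_gt0 ?divr_gt0// => /(_ isT); apply: filterS => i.
    move=> h; rewrite linearZl_LR/= normrM.
    move: h; rewrite linearZl_LR/= Tnz mulrA normrM ltr_pM2r ?normr_gt0//.
    rewrite ltr_pdivlMr// normrM normrX => h.
    have ha : `|alpha i| <= `|alpha i| * `|c| ^+ n i.
      by rewrite ler_peMr// exprn_ege1.
    apply: ltW; apply: le_lt_trans h.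
    apply: ler_pM => //; apply: le_trans (cauchy_schwarz hdot _ _) _.
    by rewrite /b ler_wpDr// ler_wpM2r// TM.
  by move/eqP; rewrite -hdot expf_eq0/= normr_eq0 (negPf x0).
have [alpha [n [_ nlt wcv]]] := ysc z.
have nge i : (i <= n i)%N.
  elim: i => // i IH; apply: leq_ltn_trans IH _; exact: nlt.
have [B BP] : exists B, forall i, `|alpha i *: iter (n i) T y| <= B.
  apply: (uniform_boundedness hdot) => w.
  have /cvg_seq_bounded : cvg (dot (alpha i *: iter (n i) T y) w @[i --> \oo]).
    by apply/cvg_ex; exists (dot z w); exact: wcv.
  move=> [B [_ BP]]; exists (B + 1) => i; apply: BP => //.
  by rewrite ltrDl.
(* |alpha i| <= B / d *)
have [d d0 dP] := orbit_bounded_below C1 y0.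
have B0 : 0 <= B := le_trans (normr_ge0 _) (BP 0%N).
move/eqP: zz0; apply.
apply: (norm_cvg_unique (wcv z)); apply/cvgr0Pnorm_le => e e0.
pose b := B / d * `|dot y z| + 1.
have b0 : 0 < b by rewrite ltr_wpDl// mulr_ge0// divr_ge0// ltW.
have [N NP] := complex_expr_lt _ _ _ c1 (divr_gt0 e0 b0).
exists N => // i /= Ni; rewrite linearZl_LR/= Tnz.
have := NP (n i) (leq_trans Ni (nge i)); rewrite ltr_pdivlMr//.
move=> /ltW; apply: le_trans.
rewrite mulrCA normrM normrX ler_wpM2l ?exprn_ge0// normrM /b ler_wpDr//.
rewrite ler_wpM2r// ler_pdivlMr//; apply: le_trans (BP i).
by rewrite normrZ ler_wpM2l// dP.
Qed.

End PowerBoundedOperator.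

(** * Emptiness of the point spectra *)

Theorem corollary4p1 (R : realType) (X : completeNormedModType R[i])
    (dot : {dot X for Num.conj}) (hdot : induces_norm dot)
    (hdim : ~ one_dimensional X)
    (T : {linear X -> X}) (hbd : bounded_operator T)
    (hpb : power_bounded T) (hC1 : class_C1 T)
    (hsc : weakly_l_seq_supercyclic dot T) :
  point_spectrum T = set0 /\ point_spectrum (adjoint dot T) = set0.
Proof.
have [M M0 TM] := power_bounded_norm hpb.
split; rewrite -subset0 => l [e e0 Te].
- have [l1|l1] := real_leP (@real1 R[i]) (normr_real l).
    have [z z0 zP] := eigenvector_gives_left_eigenvector hdot M0 TM l1 e0 Te.
    exact: (no_left_eigenvector hdot M0 TM hdim hC1 hsc z0 zP).
  apply: (hC1 e e0); apply/cvgr0Pnorm_lt => d d0.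
  have e1 : 0 < `|e| by rewrite normr_gt0.
  have [N NP] := complex_expr_lt _ _ _ l1 (divr_gt0 d0 e1).
  exists N => // n /= Nn.
  by rewrite (iter_eigenvector _ Te) normrZ normrX -ltr_pdivlMr// NP.
- apply: (no_left_eigenvector hdot M0 TM hdim hC1 hsc e0 (c := l^*)) => x.
  by rewrite (dot_adjoint hdot TM) Te dotZr.
Qed.
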